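(* The game Max-Welter is strongly miserable; that is, for every position $p$ of Max-Welter, $$(\mathcal{G}(p),\mathcal{G}^-(p)) \in \{(0,1),(1,0)\} \cup \{(k,k) : k \geq 2\}.$$
   Context: Max-Welter is played with a finite number of coins (at least one) on a semi-infinite strip of squares labeled $0,1,2,3,\ldots$ from its left end, each square containing at most one coin. A position with $k$ coins in squares $a_1<a_2<\cdots<a_k$ (nonnegative integers) is denoted $(a_1,a_2,\ldots,a_k)$. Two players move alternately; a move consists of taking the coin in the largest occupied square $a_k$ and moving it to any empty square on its left (jumping over other coins is legal). Only the rightmost coin of the current position may be moved; after a move the coins are re-indexed in increasing order. In the normal version the player who makes the last move wins; in the mis\`ere version the player who makes the last move loses. The (normal) Sprague-Grundy value $\mathcal{G}(p)$ of a position $p$ is defined recursively as the smallest nonnegative integer not equal to $\mathcal{G}(q)$ for any $q$ reachable from $p$ in one move (so a terminal position has value $0$). The mis\`ere Sprague-Grundy value $\mathcal{G}^-(p)$ is defined by: a terminal position has value $1$, and for non-terminal $p$, $\mathcal{G}^-(p)$ is the smallest nonnegative integer different from $\mathcal{G}^-(q)$ for every $q$ reachable from $p$ in one move. A game is strongly miserable if its functions $\mathcal{G}$ and $\mathcal{G}^-$ swap the values $0$ and $1$ and agree on all other values, i.e. for every position $p$, $(\mathcal{G}(p),\mathcal{G}^-(p))$ is $(0,1)$, $(1,0)$, or $(k,k)$ for some $k\ge 2$. *)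

(* Defs.v *)
From HB Require Import structures.
From mathcomp Require Import all_boot.

Set Implicit Arguments.
Unset Strict Implicit.
Unset Printing Implicit Defensive.

Lemma mex_subproof (s : seq nat) : exists n, n \notin s.
Proof.
exists (\max_(i <- s) i).+1; apply/negP => sM.
by have := @leq_bigmax_seq _ s xpredT id _ sM isT; rewrite ltnn.
Qed.

Definition mex (s : seq nat) : nat := ex_minn (mex_subproof s).

(* Impartial games with finitely many options at each position. The rank     *)
(* only witnesses that all plays are finite; by sgE and misere_sgE below, the *)
(* two Sprague-Grundy functions do not depend on it.                          *)
Record game := Game {
  pos :> eqType;
  options : pos -> seq pos;
  rank : pos -> nat;
  rank_options : forall p q, q \in options p -> rank q < rank p
}.

Fixpoint sg_rec (g : game) (n : nat) (p : g) : nat :=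
  if n is m.+1 then mex [seq sg_rec m q | q <- options p] else 0.

Fixpoint misere_sg_rec (g : game) (n : nat) (p : g) : nat :=
  if n is m.+1 then
    if options p is [::] then 1
    else mex [seq misere_sg_rec m q | q <- options p]
  else 0.

Definition sg (g : game) (p : g) : nat := sg_rec (rank p).+1 p.
Definition misere_sg (g : game) (p : g) : nat := misere_sg_rec (rank p).+1 p.

Lemma sg_rec_stable (g : game) (m n : nat) (p : g) :
  rank p < m -> rank p < n -> sg_rec m p = sg_rec n p.
Proof.
elim: m n p => [//|m IHm] [//|n] p pm pn /=; congr mex; apply/eq_in_map => q.
by move=> /rank_options qp; apply: IHm; apply: leq_trans qp _.
Qed.

Lemma misere_sg_rec_stable (g : game) (m n : nat) (p : g) :
  rank p < m -> rank p < n -> misere_sg_rec m p = misere_sg_rec n p.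
Proof.
elim: m n p => [//|m IHm] [//|n] p pm pn /=.
have: [seq misere_sg_rec m q | q <- options p]
      = [seq misere_sg_rec n q | q <- options p].
  apply/eq_in_map => q /rank_options qp.
  by apply: IHm; apply: leq_trans qp _.
by case: (options p) => [//|q s] ->.
Qed.

Lemma sgE (g : game) (p : g) : sg p = mex [seq sg q | q <- options p].
Proof.
rewrite {1}/sg /=; congr mex; apply/eq_in_map => q /rank_options qp.
exact: sg_rec_stable.
Qed.

Lemma misere_sgE (g : game) (p : g) :
  misere_sg p = if options p is [::] then 1
                else mex [seq misere_sg q | q <- options p].
Proof.
rewrite {1}/misere_sg /=.
have: [seq misere_sg_rec (rank p) q | q <- options p]
      = [seq misere_sg q | q <- options p].
  by apply/eq_in_map => q /rank_options qp; apply: misere_sg_rec_stable.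
by case: (options p) => [//|q s] ->.
Qed.

Definition strongly_miserable (g : game) : Prop :=
  forall p : g,
    [\/ (sg p, misere_sg p) = (0, 1),
        (sg p, misere_sg p) = (1, 0)
      | exists2 k, 2 <= k & (sg p, misere_sg p) = (k, k)].

(* The occupied squares, listed in increasing order. *)
Record position := Position {
  coins :> seq nat;
  coinsP : (coins != [::]) && sorted ltn coins
}.

HB.instance Definition _ := [isSub for coins].
HB.instance Definition _ := [Equality of position by <:].

Definition rightmost (p : position) : nat := last 0 p.

Definition move_coin (p : position) (b : nat) : seq nat :=
  sort leq (b :: rem (rightmost p) p).

(* The filtering done by pmap insub discards nothing: see max_welter_movesE.  *)
Definition max_welter_moves (p : position) : seq position :=
  pmap insub [seq move_coin p b | b <- iota 0 (rightmost p) & b \notin coins p].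

Lemma move_coinP (p : position) (b : nat) :
  b \notin coins p -> (move_coin p b != [::]) && sorted ltn (move_coin p b).
Proof.
have /andP[_ p_sorted] := coinsP p.
move=> bp; rewrite -size_eq0 size_sort /= ltn_sorted_uniq_leq sort_uniq /=.
rewrite sort_sorted ?andbT; last exact: leq_total.
have p_uniq : uniq p := sorted_uniq ltn_trans ltnn p_sorted.
by rewrite rem_uniq // andbT; apply: contra bp; apply: mem_rem.
Qed.

Lemma max_welter_movesE (p : position) :
  map coins (max_welter_moves p)
  = [seq move_coin p b | b <- iota 0 (rightmost p) & b \notin coins p].
Proof.
rewrite /max_welter_moves (pmap_filter (insubK _)); apply/all_filterP/allP => s.
case/mapP=> b; rewrite mem_filter => /andP[bp _] ->.
by rewrite isSome_insub /= move_coinP.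
Qed.

Lemma max_welter_rank (p q : position) :
  q \in max_welter_moves p -> sumn q < sumn p.
Proof.
move=> /(map_f coins); rewrite max_welter_movesE => /mapP[b].
rewrite mem_filter mem_iota add0n => /andP[_ /andP[_ b_lt]] ->.
have p_mem : rightmost p \in coins p.
  by rewrite /rightmost; case: p {b_lt} => -[//|x s] ? /=; apply: mem_last.
rewrite (perm_sumn (permEl (perm_sort _ _))) (perm_sumn (perm_to_rem p_mem)) /=.
by rewrite ltn_add2r.
Qed.

Definition max_welter : game := Game max_welter_rank.

(* Main.v *)
(** Let [m] be the rightmost occupied square and [k] the number of coins.
    Call a position cold if [m <= k] or if square [m - 1] is occupied. Terminal
    positions are exactly those with [m = k - 1], and they are cold. Every
    move from a cold position lowers [m] by exactly one, every non-terminal cold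
    position has a cold option, and every other position has cold options with
    both parities of [m]. Hence on cold positions the two Sprague-Grundy values
    are the parity of [m - (k - 1)] and its complement, while elsewhere the
    option values contain 0 and 1, which makes both values equal and at least
    2. *)

Require Import Defs.
From mathcomp Require Import all_boot zify.

Set Implicit Arguments.
Unset Strict Implicit.
Unset Printing Implicit Defensive.

(** * Minimal excludants and a criterion for strong miserability *)

Lemma mexP (s : seq nat) : mex s \notin s.
Proof. by rewrite /mex; case: ex_minnP. Qed.

Lemma mex_le (s : seq nat) n : n \notin s -> mex s <= n.
Proof. by rewrite /mex; case: ex_minnP => m _; apply. Qed.

Lemma eq_mex (s t : seq nat) : s =i t -> mex s = mex t.
Proof.
move=> st; apply/eqP; rewrite eqn_leq !mex_le ?mexP //; last first.
  by rewrite st mexP.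
by rewrite -st mexP.
Qed.

Lemma mex_bool (s : seq nat) (c : bool) :
  nat_of_bool c \notin s -> nat_of_bool (~~ c) \in s -> mex s = c.
Proof.
move=> cs ncs; have := mex_le cs; have := mexP s.
by case: c cs ncs => /= cs ncs; case: (mex s) => [|[|?]] //; rewrite ncs.
Qed.

Lemma mex_ge2 (s : seq nat) : (forall c : bool, nat_of_bool c \in s) -> 2 <= mex s.
Proof.
move=> s01; have := mexP s.
by case: (mex s) => [|[|?]] //; rewrite ?(s01 false) ?(s01 true).
Qed.

(** By induction on the rank, a cold [p] has values [e p] and [~~ e p], and any other position has
    two equal values, at least 2. From a cold [p], cold options only contribute the bit opposite to
    the value of [p] and the others contribute nothing below 2. *)
Lemma strongly_miserable_criterion (g : game) (cold e : pred g) :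
    (forall p, options p = [::] -> cold p && ~~ e p) ->
    (forall p q, q \in options p -> cold p -> cold q -> e q = ~~ e p) ->
    (forall p, cold p -> options p <> [::] -> exists2 q, q \in options p & cold q) ->
    (forall p c, ~~ cold p ->
       exists q, [/\ q \in options p, cold q & e q = c]) ->
  strongly_miserable g.
Proof.
move=> terminal flip cold_option both.
suff V p : if cold p then sg p = e p /\ misere_sg p = ~~ e p
           else 2 <= sg p /\ misere_sg p = sg p.
  move=> p; have := V p; case: (cold p) => -[].
    by move=> -> ->; case: (e p); [constructor 2 | constructor 1].
  by move=> sg2 ->; constructor 3; exists (sg p).
elim/ltn_ind: {p}(rank p) {-2}p (erefl (rank p)) => n IH p rp.
have {n rp}IH q : q \in options p -> if cold q then sg q = e q /\ misere_sg q = ~~ e q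
           else 2 <= sg q /\ misere_sg q = sg q.
  by move=> /rank_options qp; apply: (IH (rank q)); rewrite -?rp.
have [p0|pn0] := eqVneq (options p) [::].
  have /andP[-> /negbTE ->] := terminal _ p0.
  rewrite sgE misere_sgE p0; split=> //.
  by have := @mex_le [::] 0 isT; case: (mex _).
have mE : misere_sg p = mex [seq misere_sg q | q <- options p].
  by rewrite misere_sgE; case: (options p) pn0.
case: ifPn => [cp|ncp].
  have [r rp cr] := cold_option p cp (elimN eqP pn0).
  have := IH r rp; rewrite cr (flip _ _ rp cp cr) => -[sr mr].
  rewrite mE sgE; split; apply: mex_bool; try (by rewrite -?sr -?mr map_f).
    apply/mapP => -[q qp]; move: (IH q qp).
    case: ifP => [cq [-> _]|_ [+ _]]; last by case: (e p) => /[swap] <-.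
    by rewrite (flip _ _ qp cp cq); case: (e p).
  apply/mapP => -[q qp]; move: (IH q qp).
  case: ifP => [cq [_ ->]|_ [+ ->]]; last by case: (e p) => /[swap] <-.
  by rewrite (flip _ _ qp cp cq); case: (e p).
have sb c : exists q, [/\ q \in options p, sg q = nat_of_bool c
                                & misere_sg q = nat_of_bool (~~ c)].
  by have [q [qp cq <-]] := both p c ncp; exists q; have := IH q qp; rewrite cq => -[].
have s01 (c : bool) : nat_of_bool c \in [seq sg q | q <- options p].
  by have [q [qp <- _]] := sb c; apply: map_f.
have m01 (c : bool) : nat_of_bool c \in [seq misere_sg q | q <- options p].
  by have [q [qp _]] := sb (~~ c); rewrite negbK => <-; apply: map_f.
rewrite mE sgE; split; first exact: mex_ge2.
(* Both lists contain 0 and 1. A larger value can only come from an option that is not cold, where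
   the two functions agree. *)
apply: eq_mex => -[|[|n]]; rewrite ?(s01 false) ?(m01 false) ?(s01 true) ?(m01 true) //.
by apply/mapP/mapP => -[q qp nE]; exists q => //; move: (IH q qp) nE;
  case: (cold q) => -[] => [-> ->|_ ->] //; case: (e q).
Qed.

(** * Occupied squares and the effect of a move *)

Lemma notin_below (s : seq nat) n : size s < n -> exists2 b, b < n & b \notin s.
Proof.
move=> sn; have /allPn[b] : ~~ all (mem s) (iota 0 n).
  apply/negP => /allP ns; move: sn.
  by rewrite ltnNge -{1}(size_iota 0 n) uniq_leq_size ?iota_uniq.
by rewrite mem_iota => /andP[_ bn] bs; exists b.
Qed.

Lemma position_uniq (p : position) : uniq p.
Proof. by have /andP[_ /(sorted_uniq ltn_trans ltnn)] := coinsP p. Qed.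

Lemma rightmost_mem (p : position) : rightmost p \in coins p.
Proof. by rewrite /rightmost; case: p => -[//|x s] ? /=; apply: mem_last. Qed.

Lemma leq_rightmost (p : position) x : x \in coins p -> x <= rightmost p.
Proof.
rewrite /rightmost; case: p => s /= /andP[_ /(sub_sorted ltnW)].
case/lastP: s => // s y; rewrite last_rcons mem_rcons inE -cats1.
rewrite (sorted_pairwise leq_trans) pairwise_cat => /andP[/allrelP sy _].
by case/predU1P=> [->//|xs]; apply: sy; rewrite ?mem_head.
Qed.

Lemma rightmostE (p : position) m :
  m \in coins p -> (forall x, x \in coins p -> x <= m) -> rightmost p = m.
Proof.
move=> mp pm; apply/eqP; rewrite eqn_leq leq_rightmost // andbT.
exact/pm/rightmost_mem.
Qed.

(** The coins are distinct and lie on squares 0 to [rightmost p]. Since moves keep the number of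
    coins, this bounds from below the rightmost coin of every option. *)
Lemma size_position (p : position) : size p <= (rightmost p).+1.
Proof.
rewrite -(size_iota 0 (rightmost p).+1) uniq_leq_size ?position_uniq // => x.
by rewrite mem_iota ltnS => /leq_rightmost.
Qed.

Lemma mem_move_coin (p : position) b x :
  (x \in move_coin p b) = (x == b) || (x != rightmost p) && (x \in coins p).
Proof. by rewrite mem_sort inE mem_rem_uniq ?position_uniq // inE. Qed.

Lemma size_move_coin (p : position) b : size (move_coin p b) = size p.
Proof.
rewrite size_sort /= size_rem ?rightmost_mem // prednK //.
by have := rightmost_mem p; case: (coins p).
Qed.

Lemma max_welter_moveP (p : position) b :
    b < rightmost p -> b \notin coins p ->
  exists2 q, q \in max_welter_moves p & coins q = move_coin p b.
Proof.
move=> bm bp; have : move_coin p b \in map coins (max_welter_moves p).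
  by rewrite max_welter_movesE map_f // mem_filter bp mem_iota.
by case/mapP=> q qp ->; exists q.
Qed.

Lemma max_welter_movesP (p q : position) :
    q \in max_welter_moves p ->
  exists b, [/\ b < rightmost p, b \notin coins p & coins q = move_coin p b].
Proof.
move=> /(map_f coins); rewrite max_welter_movesE => /mapP[b].
by rewrite mem_filter mem_iota => /andP[bp /andP[_ bm]] ->; exists b.
Qed.

Lemma size_max_welter_moves (p q : position) :
  q \in max_welter_moves p -> size q = size p.
Proof. by case/max_welter_movesP=> b [_ _ ->]; rewrite size_move_coin. Qed.

Lemma rightmost_max_welter_moves (p q : position) :
  q \in max_welter_moves p -> rightmost q < rightmost p.
Proof.
case/max_welter_movesP=> b [bm _ qE]; have := rightmost_mem q.
rewrite qE mem_move_coin => /orP[/eqP->//|/andP[ne qp]].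
by rewrite ltn_neqAle ne leq_rightmost.
Qed.

Lemma size_rem_rightmost (p : position) : size (rem (rightmost p) p) = (size p).-1.
Proof. by rewrite size_rem ?rightmost_mem. Qed.

(** * Cold positions of Max-Welter *)

(** The truncated predecessor at [rightmost p = 0] is harmless, as the first disjunct then holds. *)
Definition cold (p : position) : bool :=
  (rightmost p <= size p) || ((rightmost p).-1 \in coins p).

(** This is the parity of [rightmost p - (size p - 1)], written without subtraction. *)
Definition cold_value (p : position) : bool := ~~ odd (rightmost p + size p).

Lemma max_welter_terminal (p : position) :
  max_welter_moves p = [::] -> rightmost p < size p.
Proof.
move=> p0; rewrite ltnNge; apply/negP => kp.
have sp : 0 < size p by have := rightmost_mem p; case: (coins p).
(* Discarding the moving coin leaves [size p - 1] coins, too few to fill the squares to its left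
   even when [size p = rightmost p]. *)
have [|b bm bp] := @notin_below (rem (rightmost p) p) (rightmost p).
  by rewrite size_rem_rightmost; lia.
have [||q] := @max_welter_moveP p b; rewrite ?p0 //.
apply: contra bp => bp; rewrite mem_rem_uniq ?position_uniq // inE bp andbT.
by rewrite neq_ltn bm.
Qed.

(** If [rightmost p <= size p], the coins of [q] do not fit on fewer squares; otherwise the coin on
    [(rightmost p).-1] stays in place and becomes the rightmost one. *)
Lemma cold_move (p q : position) :
    q \in max_welter_moves p -> cold p ->
  rightmost p = (rightmost q).+1.
Proof.
move=> qp cp; have qm := rightmost_max_welter_moves qp.
apply/eqP; rewrite eqn_leq qm andbT.
case/orP: cp => [kp|mp].
  by have := size_position q; rewrite (size_max_welter_moves qp); lia.
case/max_welter_movesP: (qp) => b [bm _ qE].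
suff : (rightmost p).-1 <= rightmost q by lia.
by apply: leq_rightmost; rewrite qE mem_move_coin mp andbT; apply/orP; right; lia.
Qed.

(* Fill the square left of the second rightmost coin [s], or any gap below [s]
   if that square is already occupied. *)
Lemma cold_option_below (p : position) s :
    s \in coins p -> s < rightmost p -> size p <= s.+1 ->
    (forall x, x \in coins p -> x < rightmost p -> x <= s) ->
  exists q, [/\ q \in max_welter_moves p, cold q & rightmost q = s].
Proof.
move=> sp sm ks ps.
have s_gt0 : 0 < s.
  have /uniq_leq_size : uniq [:: s; rightmost p] by rewrite /= inE andbT; lia.
  by move=> /(_ p) /= k2; suff : 1 < size p by [lia|]; apply: k2 => x;
    rewrite !inE => /orP[] /eqP->; rewrite ?rightmost_mem.
have [b [bs bp sb]] :
    exists b, [/\ b < s, b \notin coins p & (s.-1 == b) || (s.-1 \in coins p)].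
  have [s1p|s1p] := boolP (s.-1 \in coins p); last first.
    by exists s.-1; rewrite eqxx s1p; split=> //; lia.
  have sp0 : 0 < size p by case: (coins p) sp.
  (* The remaining [size p - 1] coins miss some square up to [s], and not [s] itself, which is
     occupied. *)
  have [|b bs bp] := @notin_below (rem (rightmost p) p) s.+1.
    by rewrite size_rem_rightmost; lia.
  have {}bp : b \notin coins p.
    apply: contra bp => bp; rewrite mem_rem_uniq ?position_uniq // inE bp andbT.
    by rewrite neq_ltn (leq_ltn_trans _ sm).
  exists b; split=> //; last by rewrite orbT.
  by rewrite ltn_neqAle -ltnS bs andbT; apply: contraNneq bp => ->.
have [|//|q qp qE] := @max_welter_moveP p b; first by lia.
have qm : rightmost q = s.
  apply: rightmostE => [|x]; rewrite qE mem_move_coin.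
    by rewrite sp andbT; apply/orP; right; lia.
  case/orP=> [/eqP->|/andP[xm xp]]; first by lia.
  by apply: ps => //; rewrite ltn_neqAle xm leq_rightmost.
exists q; split=> //; rewrite /cold qm qE mem_move_coin.
by case/orP: sb => ->; rewrite ?orbT //; apply/orP; right; apply/orP; right; lia.
Qed.

Lemma cold_cold_option (p : position) :
    cold p -> max_welter_moves p <> [::] ->
  exists2 q, q \in max_welter_moves p & cold q.
Proof.
move=> cp pn0.
have [r rp] : exists r, r \in max_welter_moves p.
  by case: (max_welter_moves p) pn0 => // r rs _; exists r; rewrite mem_head.
have m_gt0 : 0 < rightmost p by have := rightmost_max_welter_moves rp; lia.
have km : size p <= rightmost p.
  have := size_position r; rewrite (size_max_welter_moves rp).
  by have := rightmost_max_welter_moves rp; lia.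
have [mp|mp] := boolP ((rightmost p).-1 \in coins p).
  have [||x _|q [qp cq _]] := cold_option_below mp _ _; last by exists q.
  - by lia.
  - by lia.
  - by lia.
(* Here [rightmost p <= size p], so any move leads to a cold position. *)
have [|//|q qp qE] := @max_welter_moveP p (rightmost p).-1; first by lia.
exists q => //; rewrite /cold; case/orP: cp => [mk|]; last by rewrite (negbTE mp).
rewrite (size_max_welter_moves qp).
by have := rightmost_max_welter_moves qp; lia.
Qed.

Lemma hot_cold_option (p : position) (c : bool) :
    ~~ cold p ->
  exists q, [/\ q \in max_welter_moves p, cold q & cold_value q = c].
Proof.
rewrite negb_or -ltnNge => /andP[km mp].
(* All options have [size p] coins, so only the parity of the rightmost coin matters. *)
suff [q1 [q2 [q1p c1 q2p c2 q12]]] : exists q1 q2,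
    [/\ q1 \in max_welter_moves p, cold q1, q2 \in max_welter_moves p, cold q2
      & odd (rightmost q1) = ~~ odd (rightmost q2)].
  have : cold_value q1 = ~~ cold_value q2.
    rewrite /cold_value !oddD q12 (size_max_welter_moves q1p).
    by rewrite (size_max_welter_moves q2p) addNb.
  case: (cold_value q1 =P c) => [q1c _|q1c e12]; first by exists q1.
  exists q2; split=> //; apply/esym; move: q1c; rewrite e12.
  by case: c (cold_value q2) => -[].
pose low := rem (rightmost p) p.
have lowE x : (x \in low) = (x < rightmost p) && (x \in coins p).
  rewrite mem_rem_uniq ?position_uniq // inE ltn_neqAle.
  by have [/leq_rightmost ->|] := boolP (x \in coins p); rewrite ?andbF ?andbT.
(* The square [t] is just right of the second rightmost coin, or 0 if there is a single coin. Moving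
   there gives the cold option [q1]. *)
have [t [tm lowt tlow]] : exists t, [/\ t < rightmost p,
    forall x, x \in low -> x < t & 0 < t -> t.-1 \in low].
  have [low0|[y yl]] : low = [::] \/ exists y, y \in low.
    by case: (low) => [|y l]; [left | right; exists y; rewrite mem_head].
    by exists 0; rewrite low0; split=> //; lia.
  have lowm x : x \in low -> x <= rightmost p by rewrite lowE => /andP[/ltnW].
  have [s sl smax] := ex_maxnP (ex_intro (fun y => y \in low) y yl) lowm.
  exists s.+1; split=> //; move: sl; rewrite lowE => /andP[sm sp].
  by rewrite ltn_neqAle sm andbT; apply: contraNneq mp => <-.
have low_rightmost (q : position) b : t <= b -> b < rightmost p ->
    coins q = move_coin p b -> rightmost q = b.
  move=> tb bm qE; apply: rightmostE => [|x]; rewrite qE mem_move_coin ?eqxx //.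
  case/orP=> [/eqP->//|/andP[xm xp]].
  have : x < t by rewrite lowt // lowE xp ltn_neqAle xm leq_rightmost.
  by lia.
have low_free b : t <= b -> b < rightmost p -> b \notin coins p.
  move=> tb bm; apply/negP => bp.
  by have := lowt b; rewrite lowE bm bp => /(_ isT); lia.
have [q1 q1p q1E] := max_welter_moveP tm (low_free _ (leqnn _) tm).
have q1t := low_rightmost _ _ (leqnn _) tm q1E.
have q1c : cold q1.
  rewrite /cold q1t (size_max_welter_moves q1p).
  have [->//|/tlow] := posnP t.
  rewrite lowE q1E mem_move_coin => /andP[tm1 ->]; rewrite (ltn_eqF tm1).
  by rewrite !orbT.
have kt : size p <= t.+1.
  have : size low <= t.
    rewrite -(size_iota 0 t) uniq_leq_size ?rem_uniq ?position_uniq // => x.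
    by rewrite mem_iota; apply: lowt.
  by rewrite size_rem_rightmost; lia.
(* If [size p <= t], there is room to make the coin on [t.-1] the rightmost one of a cold option.
   Otherwise [size p = t.+1], and moving to [t.+1] is cold because [t.+1 <= size p]. Either way the
   rightmost coin differs by one from that of [q1]. *)
have [kt'|tk] := leqP (size p) t.
  have t_gt0 : 0 < t by have := rightmost_mem p; case: (coins p) kt' => //=; lia.
  have := tlow t_gt0; rewrite lowE => /andP[t1m t1p].
  have [|x xp xm|q2 [q2p q2c q2t]] := cold_option_below t1p t1m.
  - by lia.
  - by have := lowt x; rewrite lowE xp xm => /(_ isT); lia.
  exists q1, q2; split=> //; rewrite q1t q2t.
  by rewrite -{1}(prednK t_gt0).
have Stm : t.+1 < rightmost p by lia.
have [q2 q2p q2E] := max_welter_moveP Stm (low_free _ (leqnSn _) Stm).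
have q2t := low_rightmost _ _ (leqnSn _) Stm q2E.
exists q1, q2; split=> //; last by rewrite q1t q2t /= negbK.
by rewrite /cold q2t (size_max_welter_moves q2p) tk.
Qed.

Theorem theorem9 : strongly_miserable max_welter.
Proof.
apply: (@strongly_miserable_criterion max_welter cold cold_value).
- move=> p /max_welter_terminal mk; rewrite /cold ltnW //= /cold_value negbK.
  suff -> : size p = (rightmost p).+1 by rewrite addnS oddS addnn odd_double.
  by apply/eqP; rewrite eqn_leq size_position.
- move=> p q qp cp _; rewrite /cold_value (@cold_move p q qp cp).
  by rewrite (size_max_welter_moves qp) addSn oddS negbK.
- exact: cold_cold_option.
- exact: hot_cold_option.
Qed.
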